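(* Let $(X,M)$ be a symmetric generalised uniform space. The isometry $i_X\colon(X,M)\to(\mathrm{Pt}(\mathcal U(X)),\widetilde M)$, $i_X(x)=\Diamond x$, where $\widetilde M=\{\widetilde d\mid d\in M\}$, is a completion of $(X,M)$.
   Context: Foundations: constructive (no excluded middle or choice), but for this result impredicative: $\mathrm{Pow}(S)$, the collection of subsets of $S$, is assumed to be a set for every set $S$. Formal topologies: a formal topology is $\mathcal S=(S,\lhd,\le)$ with $(S,\le)$ a preordered set and $\lhd$ a relation between $S$ and $\mathrm{Pow}(S)$ (a cover) such that for all $a,b\in S$, $U,V\subseteq S$: (1) $U\lhd U$; (2) $a\lhd U$ and $U\lhd V$ imply $a\lhd V$; (3) $a\lhd U$ and $a\lhd V$ imply $a\lhd U\downarrow V$; (4) $a\le b$ implies $a\lhd b$. Here $U\lhd V$ means $\forall a\in U\ (a\lhd V)$, $U\downarrow V=\{c\mid\exists a\in U\,\exists b\in V\ (c\le a,\ c\le b)\}$, and singletons are written as elements. The cover inductively generated on a preorder by given axioms $a\lhd C$ is the least cover (making the preorder a formal topology) that satisfies the axioms. A formal point of $\mathcal S$ is a subset $\alpha\subseteq S$ such that $\alpha$ is inhabited; $a,b\in\alpha$ implies $\alpha\cap(a\downarrow b)$ inhabited; $a\in\alpha$ and $a\lhd U$ imply $\alpha\cap U$ inhabited. $\mathrm{Pt}(\mathcal S)$ is the collection of formal points. Upper reals: $\mathbb R^u$ consists of subsets $U\subseteq\mathbb Q^{>0}$ with $q\in U\iff\exists q'<q\,(q'\in U)$ (possibly empty).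 $U\le V$ iff $V\subseteq U$; $U+V=\{q_1+q_2\mid q_1\in U,q_2\in V\}$; a non-negative rational $r$ is identified with $\{q\mid r<q\}$; $U<V$ iff $U+r\le V$ for some $r\in\mathbb Q^{>0}$ (so $U<q\iff q\in U$). Generalised uniform spaces: a generalised metric on $X$ is $d\colon X\times X\to\mathbb R^u$ with $d(x,x)=0$ and $d(x,z)\le d(x,y)+d(y,z)$; generalised metrics are ordered pointwise; $d$ is symmetric if $d(x,y)=d(y,x)$. A generalised uniform space (gus) is $(X,M)$ with $M$ a set of generalised metrics on $X$ that is inhabited and closed under binary sups; it is symmetric if each $d\in M$ is. Localic completion: for a gus $(X,M)$ let $U_X=M\times\mathbb Q^{>0}\times X$, with elements written $\mathsf b_d(x,\varepsilon)$. Put $\mathsf b_d(y,\delta)\le_X\mathsf b_\rho(x,\varepsilon)$ iff $\rho\le d$ and $\rho(x,y)+\delta\le\varepsilon$; and $\mathsf b_d(y,\delta)<_X\mathsf b_\rho(x,\varepsilon)$ iff $\rho\le d$ and $\rho(x,y)+\delta<\varepsilon$. $\mathcal U(X)=(U_X,\lhd_X,\le_X)$ where $\lhd_X$ is inductively generated by the axioms, for all $a\in U_X$: (U1) $a\lhd_X\{b\mid b<_Xa\}$; (U2) $a\lhd_X\mathcal C_d^\varepsilon$ for each $d\in M$, $\varepsilon\in\mathbb Q^{>0}$, where $\mathcal C_d^\varepsilon=\{\mathsf b_d(x,\varepsilon)\mid x\in X\}$. The open ball of $\mathsf b_d(x,\varepsilon)$ is $\mathrm B_d(x,\varepsilon)=\{x'\in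 X\mid d(x,x')<\varepsilon\}$, and for $x\in X$, $\Diamond x=\{\mathsf b_d(y,\varepsilon)\in U_X\mid d(y,x)<\varepsilon\}$, which is a formal point. For $d\in M$ and $\alpha,\beta\in\mathrm{Pt}(\mathcal U(X))$, $\widetilde d(\alpha,\beta)=\{q\in\mathbb Q^{>0}\mid\exists\,\mathsf b_d(x,\varepsilon)\in\alpha,\ \exists\,\mathsf b_d(y,\delta)\in\beta,\ d(x,y)+\varepsilon+\delta<q\}$; this is a symmetric generalised metric on $\mathrm{Pt}(\mathcal U(X))$. A Cauchy filter on a symmetric gus $(X,M)$ is a set $\mathcal F$ of inhabited subsets of $X$, closed under supersets and binary intersections, such that for all $d\in M$, $\varepsilon\in\mathbb Q^{>0}$ there is $x\in X$ with $\mathrm B_d(x,\varepsilon)\in\mathcal F$. It converges to $x$ if $\mathrm B_d(x,\varepsilon)\in\mathcal F$ for all $d,\varepsilon$. The gus is complete if every Cauchy filter converges to some point, and separated if $[\forall d\in M\ d(x,y)=0]\iff x=y$. That $i_X$ is a completion means: $(\mathrm{Pt}(\mathcal U(X)),\widetilde M)$ is a complete separated symmetric gus, $i_X$ is an isometry ($d(x,y)=\widetilde d(\Diamond x,\Diamond y)$ for all $d\in M$, $x,y\in X$), and $i_X$ has dense image (for all $\alpha\in\mathrm{Pt}(\mathcal U(X))$, $d\in M$, $\varepsilon\in\mathbb Q^{>0}$ there is $x\in X$ with $\widetilde d(\alpha,\Diamond x)<\varepsilon$). *)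

(* Defs.v *)
From mathcomp Require Import all_boot all_order all_algebra.
From mathcomp Require Import interval_inference lra.

Set Implicit Arguments.
Unset Strict Implicit.
Unset Printing Implicit Defensive.

Import Order.TTheory GRing.Theory Num.Theory.
Local Open Scope ring_scope.

(* Subsets of [T] are predicates [T -> Prop], and the singleton {a} is [eq a].
   Equality of upper reals, distances and formal points is Leibniz equality; by
   propositional and functional extensionality it is equality of subsets. *)

Notation Qpos := {posnum rat}.

Record upper_real := UpperReal {
  ur_set :> Qpos -> Prop;
  ur_rounded : forall q, ur_set q <-> exists q', q'%:num < q%:num /\ ur_set q'
}.

(* An upper real is the set of its strict upper bounds, so the order is reverse
   inclusion; the empty set is infinity. *)
Definition ur_le (U V : upper_real) : Prop := forall q, V q -> U q.

Definition ur_add_set (U V : upper_real) (q : Qpos) : Prop :=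
  exists q1 q2, [/\ U q1, V q2 & q%:num = q1%:num + q2%:num].

Lemma ur_add_rounded U V q : ur_add_set U V q <->
  exists q', q'%:num < q%:num /\ ur_add_set U V q'.
Proof.
split=> [[q1 [q2 [Uq1 Vq2 ->]]] | [q' [q'q [q1 [q2 [Uq1 Vq2 q'E]]]]]].
  have [/(_ Uq1)[q1' [lt1 Uq1']] _] := ur_rounded U q1.
  exists (q1'%:num + q2%:num)%:pos; split=> /=; first by rewrite ltrD2r.
  by exists q1', q2.
have lt2 : q2%:num < q%:num - q1%:num by lra.
have gt0 : 0 < q%:num - q1%:num by apply: lt_trans lt2.
exists q1, (PosNum gt0); split=> //=; last by lra.
by apply/ur_rounded; exists q2.
Qed.

Definition ur_add (U V : upper_real) : upper_real :=
  UpperReal (ur_add_rounded U V).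

Lemma ur_rat_rounded (r : {nonneg rat}) (q : Qpos) : r%:num < q%:num <->
  exists q' : Qpos, q'%:num < q%:num /\ r%:num < q'%:num.
Proof.
split=> [rq | [q' [lt1 lt2]]]; last exact: lt_trans lt1.
have r0 : 0 <= r%:num by [].
have gt0 : 0 < (r%:num + q%:num) / 2 by lra.
by exists (PosNum gt0) => /=; split; lra.
Qed.

Definition ur_rat (r : {nonneg rat}) : upper_real :=
  UpperReal (ur_rat_rounded r).

Definition ur_zero : upper_real := ur_rat 0%:nng.

Definition ur_pos (q : Qpos) : upper_real := ur_rat q%:num%:nng.
Declare Scope upper_real_scope.
Delimit Scope upper_real_scope with ur.
Bind Scope upper_real_scope with upper_real.
Notation "q %:ur" := (ur_pos q)
  (at level 2, left associativity, format "q %:ur") : upper_real_scope.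

Definition ur_lt (U V : upper_real) : Prop :=
  exists r : Qpos, ur_le (ur_add U r%:ur) V.

Notation "U + V" := (ur_add U V) : upper_real_scope.
Notation "U <= V" := (ur_le U V) : upper_real_scope.
Notation "U < V" := (ur_lt U V) : upper_real_scope.

Notation distance X := (X -> X -> upper_real).

Record gmetric (X : Type) (d : distance X) : Prop := GMetric {
  gm_refl : forall x, d x x = ur_zero;
  gm_triangle : forall x y z, (d x z <= d x y + d y z)%ur
}.

Definition dist_le (X : Type) (d e : distance X) : Prop :=
  forall x y, (d x y <= e x y)%ur.

(* Binary supremum in the poset of generalised metrics on [X]. *)
Definition is_sup (X : Type) (d e s : distance X) : Prop :=
  [/\ gmetric s, dist_le d s, dist_le e s &
      forall t, gmetric t -> dist_le d t -> dist_le e t -> dist_le s t].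

Record is_gus (X : Type) (M : distance X -> Prop) : Prop := IsGus {
  gus_gmetric : forall d, M d -> gmetric d;
  gus_inhabited : exists d, M d;
  gus_sup : forall d e, M d -> M e -> exists s, M s /\ is_sup d e s
}.

Record gus := Gus {
  gus_car :> Type;
  gus_dist : distance gus_car -> Prop;
  gus_axioms : is_gus gus_dist
}.

Definition symmetric_gus (X : Type) (M : distance X -> Prop) : Prop :=
  forall d, M d -> forall x y, d x y = d y x.

Definition open_ball (X : Type) (d : distance X) (x : X) (eps : Qpos) :
    X -> Prop :=
  fun x' => (d x x' < eps%:ur)%ur.

Record cauchy_filter (X : Type) (M : distance X -> Prop)
    (F : (X -> Prop) -> Prop) : Prop := CauchyFilter {
  cf_inhabited : forall A, F A -> exists x, A x;
  cf_superset : forall A B : X -> Prop, (forall x, A x -> B x) -> F A -> F B;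
  cf_inter : forall A B, F A -> F B -> F (fun x => A x /\ B x);
  cf_cauchy : forall d, M d -> forall eps, exists x, F (open_ball d x eps)
}.

Definition converges (X : Type) (M : distance X -> Prop)
    (F : (X -> Prop) -> Prop) (x : X) : Prop :=
  forall d, M d -> forall eps, F (open_ball d x eps).

Definition complete_gus (X : Type) (M : distance X -> Prop) : Prop :=
  forall F, cauchy_filter M F -> exists x, converges M F x.

Definition separated_gus (X : Type) (M : distance X -> Prop) : Prop :=
  forall x y, (forall d, M d -> d x y = ur_zero) <-> x = y.

Definition down (S : Type) (le : S -> S -> Prop) (U V : S -> Prop) :
    S -> Prop :=
  fun c => exists a b, [/\ U a, V b, le c a & le c b].

Record formal_topology := FormalTopology {
  ft_car :> Type;
  ft_le : ft_car -> ft_car -> Prop;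
  ft_cov : ft_car -> (ft_car -> Prop) -> Prop;
  ft_le_refl : forall a, ft_le a a;
  ft_le_trans : forall a b c, ft_le a b -> ft_le b c -> ft_le a c;
  ft_cov_refl : forall (U : ft_car -> Prop) a, U a -> ft_cov a U;
  ft_cov_trans : forall a U V,
    ft_cov a U -> (forall b, U b -> ft_cov b V) -> ft_cov a V;
  ft_cov_down : forall a U V,
    ft_cov a U -> ft_cov a V -> ft_cov a (down ft_le U V);
  ft_cov_le : forall a b, ft_le a b -> ft_cov a (eq b)
}.

Record formal_point (S : formal_topology) := FormalPoint {
  fp_set :> S -> Prop;
  fp_inhabited : exists a, fp_set a;
  fp_down : forall a b, fp_set a -> fp_set b ->
    exists c, fp_set c /\ down (@ft_le S) (eq a) (eq b) c;
  fp_cov : forall a U, fp_set a -> ft_cov a U -> exists b, fp_set b /\ U b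
}.

(* The least relation closed under the four laws of a cover on [le] and
   satisfying the axioms [ax], hence the least such cover. *)
Inductive gen_cov (S : Type) (le : S -> S -> Prop)
    (ax : S -> (S -> Prop) -> Prop) : S -> (S -> Prop) -> Prop :=
| gen_refl (U : S -> Prop) a : U a -> gen_cov le ax a U
| gen_trans a U V : gen_cov le ax a U ->
    (forall b, U b -> gen_cov le ax b V) -> gen_cov le ax a V
| gen_down a U V : gen_cov le ax a U -> gen_cov le ax a V ->
    gen_cov le ax a (down le U V)
| gen_le a b : le a b -> gen_cov le ax a (eq b)
| gen_ax a C : ax a C -> gen_cov le ax a C.

Lemma ur_up (U : upper_real) (p q : Qpos) : p%:num <= q%:num -> U p -> U q.
Proof.
move=> pq /ur_rounded[p' [lt Up']]; apply/ur_rounded; exists p'; split=> //.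
exact: lt_le_trans pq.
Qed.

Lemma ur_lt_posE (U : upper_real) (q : Qpos) : (U < q%:ur)%ur <-> U q.
Proof.
split=> [[r le_q] | Uq].
  have /le_q[u [s [Uu rs qE]]] : ur_pos q (q%:num + r%:num)%:pos.
    by rewrite /= ltrDl.
  by apply: ur_up Uu; move: rs qE => /=; lra.
have /ur_rounded[p [pq Up]] := Uq.
have gt0 : 0 < q%:num - p%:num by lra.
exists (PosNum gt0) => t /= qt.
have gt0' : 0 < t%:num - p%:num by lra.
by exists p, (PosNum gt0'); split=> //=; lra.
Qed.

Lemma ur_add_posE (U : upper_real) (p q : Qpos) :
  (U + p%:ur)%ur q <-> exists u, U u /\ u%:num + p%:num < q%:num.
Proof.
split=> [[u [s [Uu /= ps qE]]] | [u [Uu lt]]].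
  by exists u; split=> //; lra.
have gt0 : 0 < q%:num - u%:num by have p0 : 0 < p%:num by []; lra.
by exists u, (PosNum gt0); split=> //=; lra.
Qed.

Lemma ur_add_pos_le (U : upper_real) (u p q : Qpos) :
  U u -> u%:num + p%:num <= q%:num -> (U + p%:ur <= q%:ur)%ur.
Proof.
by move=> Uu le t /= qt; apply/ur_add_posE; exists u; split=> //; lra.
Qed.

Section LocalicCompletion.
Variable X : gus.

Definition metric : Type := {d : distance X | gus_dist d}.

Definition metric_fun (d : metric) : distance X := sval d.
Coercion metric_fun : metric >-> Funclass.

Record ball := Ball { ball_metric : metric; ball_radius : Qpos; ball_center : X }.

Definition ball_le (b a : ball) : Prop :=
  let: Ball d delta y := b in let: Ball rho eps x := a in
  dist_le rho d /\ (rho x y + delta%:ur <= eps%:ur)%ur.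

Definition ball_lt (b a : ball) : Prop :=
  let: Ball d delta y := b in let: Ball rho eps x := a in
  dist_le rho d /\ (rho x y + delta%:ur < eps%:ur)%ur.

Definition uniform_cover (d : metric) (eps : Qpos) : ball -> Prop :=
  fun b => exists x, b = Ball d eps x.

Inductive uniform_axiom : ball -> (ball -> Prop) -> Prop :=
| axiom_U1 a : uniform_axiom a (fun b => ball_lt b a)
| axiom_U2 a d eps : uniform_axiom a (uniform_cover d eps).

Definition ball_cov : ball -> (ball -> Prop) -> Prop :=
  gen_cov ball_le uniform_axiom.

Lemma metric_gmetric (d : metric) : gmetric d.
Proof. exact: gus_gmetric (gus_axioms X) _ (svalP d). Qed.

Lemma metric_refl (d : metric) x (q : Qpos) : d x x q.
Proof. by rewrite (gm_refl (metric_gmetric d)) /=. Qed.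

Lemma ball_le_refl a : ball_le a a.
Proof.
case: a => d eps x; split; first by move=> y z q.
move=> q /= lt; apply/ur_add_posE.
have gt0 : 0 < (q%:num - eps%:num) / 2 by lra.
by exists (PosNum gt0); split=> /=; [exact: metric_refl | lra].
Qed.

Lemma ball_le_trans a b c : ball_le a b -> ball_le b c -> ball_le a c.
Proof.
case: a b c => [d1 e1 x1] [d2 e2 x2] [d3 e3 x3] /= [le21 le1] [le32 le2].
split=> [x y q /le21/le32 // | q /le2/ur_add_posE[u [d3u lt]]].
have gt0 : 0 < q%:num - u%:num by have e0 : 0 < e2%:num by []; lra.
have /le1/ur_add_posE[v [d2v lt']] : ur_pos e2 (PosNum gt0) by rewrite /=; lra.
apply/ur_add_posE; exists (u%:num + v%:num)%:pos; split; last first.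
  by move: lt' => /=; lra.
apply: (gm_triangle (metric_gmetric d3) (y := x2)).
by exists u, v; split=> //; apply: le32.
Qed.

Definition localic_completion : formal_topology :=
  @FormalTopology ball ball_le ball_cov ball_le_refl ball_le_trans
    (@gen_refl _ _ _) (@gen_trans _ _ _) (@gen_down _ _ _) (@gen_le _ _ _).

Definition Pt : Type := formal_point localic_completion.

Definition diamond_set (x : X) (b : ball) : Prop :=
  (ball_metric b (ball_center b) x < (ball_radius b)%:ur)%ur.

Lemma diamond_inhabited x : exists a, diamond_set x a.
Proof.
have [d Md] := gus_inhabited (gus_axioms X).
exists (Ball (exist _ d Md) 1%:pos x).
by apply/ur_lt_posE; apply: metric_refl.
Qed.

Lemma diamond_down x a b : diamond_set x a -> diamond_set x b ->
  exists c, diamond_set x c /\ down ball_le (eq a) (eq b) c.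
Proof.
case: a b => [d e y] [d' e' y'].
move=> /ur_lt_posE /= /ur_rounded[u [ltu du]].
move=> /ur_lt_posE /= /ur_rounded[v [ltv dv]].
have [s [Ms [_ ds d's _]]] := gus_sup (gus_axioms X) (svalP d) (svalP d').
have gt0 : 0 < Num.min (e%:num - u%:num) (e'%:num - v%:num).
  by rewrite lt_min !subr_gt0 ltu.
exists (Ball (exist _ s Ms) (PosNum gt0) x); split.
  by apply/ur_lt_posE; apply: metric_refl.
exists (Ball d e y), (Ball d' e' y'); split=> //; split=> //.
  by apply: (ur_add_pos_le du); rewrite -lerBrDl ge_min lexx.
by apply: (ur_add_pos_le dv); rewrite -lerBrDl ge_min lexx orbT.
Qed.

Lemma diamond_up x a b : ball_le a b -> diamond_set x a -> diamond_set x b.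
Proof.
case: a b => [d e y] [d' e' y'] [led le] /ur_lt_posE /= /ur_rounded[u [ltu du]].
apply/ur_lt_posE => /=.
have gt0 : 0 < e'%:num + (e%:num - u%:num).
  by rewrite addr_gt0 ?subr_gt0.
have /le/ur_add_posE[v [d'v lt]] : ur_pos e' (PosNum gt0).
  by rewrite /= ltrDl subr_gt0.
apply: (@ur_up _ (v%:num + u%:num)%:pos); first by move: lt => /=; lra.
apply: (gm_triangle (metric_gmetric d') (y := y)).
by exists v, u; split=> //; apply: led.
Qed.

Lemma diamond_cov x a U : diamond_set x a -> ball_cov a U ->
  exists b, diamond_set x b /\ U b.
Proof.
move=> xa aU; elim: aU xa => {a U}.
- by move=> U a Ua xa; exists a.
- by move=> a U V _ IHU _ IHV /IHU[b [xb Ub]]; apply: (IHV b).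
- move=> a U V _ IHU _ IHV xa.
  have [[b [xb Ub]] [c [xc Vc]]] := (IHU xa, IHV xa).
  have [e [xe [_ [_ [<- <- eb ec]]]]] := diamond_down xb xc.
  by exists e; split=> //; exists b, c.
- by move=> a b ab xa; exists b; split=> //; apply: diamond_up xa.
move=> a _ [{}a|{}a d eps] xa; last first.
  exists (Ball d eps x); split; last by exists x.
  by apply/ur_lt_posE; apply: metric_refl.
case: a xa => d e y /ur_lt_posE /= /ur_rounded[u [ltu du]].
have gt0 : 0 < (e%:num - u%:num) / 2 by lra.
exists (Ball d (PosNum gt0) x); split.
  by apply/ur_lt_posE; apply: metric_refl.
split; first by move=> z t q.
by apply/ur_lt_posE/ur_add_posE; exists u; split=> //=; lra.
Qed.

Definition diamond (x : X) : Pt :=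
  @FormalPoint localic_completion (diamond_set x) (diamond_inhabited x)
    (@diamond_down x) (@diamond_cov x).

Definition tilde_set (d : metric) (alpha beta : Pt) (q : Qpos) : Prop :=
  exists x eps y delta,
    [/\ alpha (Ball d eps x), beta (Ball d delta y) &
        (d x y + eps%:ur + delta%:ur < q%:ur)%ur].

Lemma tilde_rounded d alpha beta q : tilde_set d alpha beta q <->
  exists q', q'%:num < q%:num /\ tilde_set d alpha beta q'.
Proof.
split=> [[x [eps [y [delta [ax b_y /ur_lt_posE lt]]]]] | ].
  have /ur_rounded[q' [q'q lt']] := lt.
  exists q'; split=> //; exists x, eps, y, delta; split=> //.
  exact/ur_lt_posE.
move=> [q' [q'q [x [eps [y [delta [ax b_y /ur_lt_posE lt]]]]]]].
exists x, eps, y, delta; split=> //; apply/ur_lt_posE.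
exact: ur_up (ltW q'q) lt.
Qed.

Definition tilde (d : metric) : distance Pt :=
  fun alpha beta => UpperReal (tilde_rounded d alpha beta).

End LocalicCompletion.

Definition image_family (X : gus) (Y : Type) (lift : metric X -> distance Y) :
    distance Y -> Prop :=
  fun e => exists d, e = lift d.

(* [lift] sends each metric of [X] to the corresponding one on [Y]; the metrics
   of [Y] are exactly the values of [lift]. *)
Record is_completion (X : gus) (Y : Type) (lift : metric X -> distance Y)
    (i : X -> Y) : Prop := IsCompletion {
  compl_gus : is_gus (image_family lift);
  compl_symmetric : symmetric_gus (image_family lift);
  compl_complete : complete_gus (image_family lift);
  compl_separated : separated_gus (image_family lift);
  compl_isometry : forall (d : metric X) x y, d x y = lift d (i x) (i y);
  compl_dense : forall (y : Y) (d : metric X) (eps : Qpos),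
    exists x, (lift d y (i x) < eps%:ur)%ur
}.

(* Main.v *)
(* Two balls of one formal point have a common refinement in it, so their centres
   are closer than the sum of their radii. Hence, if the ball b_d(x, eps) is in
   alpha and q is in the distance from alpha to beta, then b_d(x, eps + q) is in
   beta; this gives the triangle inequality, and with (U1) that points at
   distance 0 are equal. Binary sups of metrics are pointwise, so the lift to
   formal points preserves them. A Cauchy filter F converges to the formal point
   of all balls a having some b <_X a such that the formal points containing b
   form a member of F. *)

From mathcomp Require Import all_boot all_order all_algebra.
From mathcomp Require Import interval_inference lra boolp.
Require Import Defs.

Set Implicit Arguments.
Unset Strict Implicit.
Unset Printing Implicit Defensive.

Import Order.TTheory GRing.Theory Num.Theory.
Local Open Scope ring_scope.

(** * Extensionality and maxima of upper reals *)

Lemma Qpos_gt0 (q : Qpos) : 0 < q%:num.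
Proof. by []. Qed.

Lemma upper_real_ext (U V : upper_real) : (forall q, U q <-> V q) -> U = V.
Proof.
case: U V => [U rU] [V rV] /= UV.
have E : U = V by apply: funext => q; apply: propext.
by case: V / E rV {UV} => rV; rewrite (Prop_irrelevance rU rV).
Qed.

Lemma ur_eq_zero (U : upper_real) : (forall q, U q) -> U = ur_zero.
Proof. by move=> U0; apply: upper_real_ext => q; split=> _ /=. Qed.

Lemma formal_point_ext (S : formal_topology) (alpha beta : formal_point S) :
  (forall a, alpha a <-> beta a) -> alpha = beta.
Proof.
case: alpha beta => [A iA dA cA] [B iB dB cB] /= AB.
have E : A = B by apply: funext => a; apply: propext.
case: B / E iB dB cB {AB} => iB dB cB.
by rewrite (Prop_irrelevance iA iB) (Prop_irrelevance dA dB)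
  (Prop_irrelevance cA cB).
Qed.

Lemma gm_triangle_num (X : Type) (d : distance X) x y z (u v w : Qpos) :
  gmetric d -> d x y u -> d y z v -> u%:num + v%:num <= w%:num -> d x z w.
Proof.
move=> md dxy dyz le; apply: (@ur_up _ (u%:num + v%:num)%:pos) => //.
by apply: (gm_triangle md (y := y)); exists u, v.
Qed.

Lemma dist_le_refl (X : Type) (d : distance X) : dist_le d d.
Proof. by move=> x y q. Qed.
#[local] Hint Resolve dist_le_refl : core.

Lemma ur_max_rounded (U V : upper_real) (q : Qpos) : U q /\ V q <->
  exists q', q'%:num < q%:num /\ (U q' /\ V q').
Proof.
split=> [[/ur_rounded[u [uq Uu]] /ur_rounded[v [vq Vv]]] | [q' [lt [Uq Vq]]]].
  have [uv|vu] := leP u%:num v%:num.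
    by exists v; do 2?split=> //; apply: ur_up Uu.
  by exists u; do 2?split=> //; apply: ur_up Vv => //; apply: ltW.
by split; apply: ur_up (ltW lt) _.
Qed.

Definition ur_max (U V : upper_real) : upper_real :=
  UpperReal (ur_max_rounded U V).

Lemma gmetric_max (X : Type) (d e : distance X) : gmetric d -> gmetric e ->
  gmetric (fun x y => ur_max (d x y) (e x y)).
Proof.
move=> md me; split=> [x|x y z q [u [v [[du eu] [dv ev] qE]]]].
  by apply: ur_eq_zero => q; split; rewrite (gm_refl md, gm_refl me) /=.
by split; [apply: gm_triangle_num md du dv _ | apply: gm_triangle_num me eu ev _];
  rewrite qE.
Qed.

(** The pointwise maximum (intersection of upper reals) is a generalised metric above [d] and [e],
    so the least such metric [s] lies below it. *)
Lemma is_sup_ptwise (X : Type) (d e s : distance X) x y q :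
  gmetric d -> gmetric e -> is_sup d e s -> d x y q -> e x y q -> s x y q.
Proof.
move=> md me [_ _ _ /(_ _ (gmetric_max md me)) sle] dq eq.
by apply: sle => // [? ? ? []|? ? ? []].
Qed.

Section Completion.
Variable X : gus.
Hypothesis symX : symmetric_gus (@gus_dist X).

Implicit Types (d e s : metric X) (x y z : X) (alpha beta gamma : Pt X).
Implicit Types (a b c : ball X) (eps delta q r u v w : Qpos).

(** * Distances and the two orders on balls *)

Lemma metric_sym d x y : d x y = d y x.
Proof. exact: symX (svalP d) x y. Qed.

Lemma metric_triangle d x y z u v w :
  d x y u -> d y z v -> u%:num + v%:num <= w%:num -> d x z w.
Proof. exact: gm_triangle_num (metric_gmetric d). Qed.

Lemma metric_sup d e : exists s : metric X, is_sup d e s.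
Proof.
have [s [Ms sup]] := gus_sup (gus_axioms X) (svalP d) (svalP e).
by exists (exist _ s Ms).
Qed.

Lemma ball_ltP d delta y e eps x :
  ball_lt (Ball d delta y) (Ball e eps x) <->
  dist_le e d /\ exists u, e x y u /\ u%:num + delta%:num < eps%:num.
Proof.
by split=> /= -[le lt]; split=> //; [apply/ur_add_posE/ur_lt_posE
  | apply/ur_lt_posE/ur_add_posE].
Qed.

Lemma ball_le_num d delta y e eps x u : dist_le e d ->
  e x y u -> u%:num + delta%:num <= eps%:num ->
  ball_le (Ball d delta y) (Ball e eps x).
Proof. by move=> le exy leu; split=> //; apply: ur_add_pos_le exy leu. Qed.

Lemma ball_le_center d delta e eps x : dist_le e d ->
  delta%:num <= eps%:num -> ball_le (Ball d delta x) (Ball e eps x).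
Proof.
move=> le leq; split=> // q /= lt; apply/ur_add_posE.
have gt0 : 0 < (q%:num - eps%:num) / 2 by lra.
by exists (PosNum gt0); split=> /=; [exact: metric_refl | lra].
Qed.

Lemma ball_lt_center d delta eps x :
  delta%:num < eps%:num -> ball_lt (Ball d delta x) (Ball d eps x).
Proof.
move=> lt; apply/ball_ltP; split=> //.
have gt0 : 0 < (eps%:num - delta%:num) / 2 by lra.
by exists (PosNum gt0); split=> /=; [exact: metric_refl | lra].
Qed.

Lemma ball_le_dist d delta y e eps x : ball_le (Ball d delta y) (Ball e eps x) ->
  e x y eps.
Proof.
move=> [_ le].
(* Evaluating at [eps + delta], strictly above [eps], cancels the radius [delta] and leaves
   [u < eps]. *)
have /le/ur_add_posE[u [exy lt]] : ur_pos eps (eps%:num + delta%:num)%:pos.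
  by rewrite /= ltrDl.
by apply: ur_up exy; move: lt => /=; lra.
Qed.

Lemma ball_lt_le_trans a b c : ball_lt a b -> ball_le b c -> ball_lt a c.
Proof.
case: a b c => [d1 e1 x1] [d2 e2 x2] [d3 e3 x3] /ball_ltP[le21 [u [d2u lt]]].
move=> [le32 le]; apply/ball_ltP; split=> [x y q /le21/le32 //|].
(* The non-strict comparison can only be read above [e3]; the gap of the strict one absorbs the
   excess. *)
have gt0 : 0 < e3%:num + (e2%:num - u%:num - e1%:num).
  by rewrite addr_gt0 //; lra.
have /le/ur_add_posE[v [d3v ltv]] : ur_pos e3 (PosNum gt0) by rewrite /=; lra.
exists (v%:num + u%:num)%:pos; split; last by move: ltv => /=; lra.
by apply: metric_triangle d3v (le32 _ _ _ d2u) _.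
Qed.

Lemma ball_lt_interpolate a b : ball_lt a b ->
  exists c, ball_lt a c /\ ball_lt c b.
Proof.
case: a b => [d delta y] [e eps x] /ball_ltP[le [u [exy lt]]].
(* The new radius is the midpoint of [delta] and [eps - u]. *)
have gt0 : 0 < (eps%:num + delta%:num - u%:num) / 2.
  by have := Qpos_gt0 delta; lra.
exists (Ball d (PosNum gt0) y); split; first by apply: ball_lt_center => /=; lra.
by apply/ball_ltP; split=> //; exists u; split=> //=; lra.
Qed.

(** * Balls belonging to a formal point *)

Lemma fp_up alpha a b : alpha a -> ball_le a b -> alpha b.
Proof.
move=> aa ab.
by have [c [ac ->]] := fp_cov aa (@gen_le _ _ (@uniform_axiom X) _ _ ab).
Qed.

Lemma fp_small alpha d eps : exists x, alpha (Ball d eps x).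
Proof.
have [a aa] := fp_inhabited alpha.
have [b [ab [x bE]]] := fp_cov aa (gen_ax (@ball_le X) (axiom_U2 a d eps)).
by exists x; rewrite -bE.
Qed.

Lemma fp_lt alpha a : alpha a -> exists b, alpha b /\ ball_lt b a.
Proof. by move=> aa; exact: fp_cov aa (gen_ax (@ball_le X) (axiom_U1 a)). Qed.

(** A common refinement has its centre within [eps] of [x] and [delta] of [y]; symmetry joins the
    two estimates. Both metrics dominate [d], so the estimates hold for [d] as well. *)
Lemma fp_dist alpha d e eps x s delta y q :
  alpha (Ball e eps x) -> alpha (Ball s delta y) ->
  dist_le d e -> dist_le d s -> eps%:num + delta%:num <= q%:num -> d x y q.
Proof.
move=> ax ay de ds le.
have [[t w z] [_ [_ [_ [<- <- /ball_le_dist exz /ball_le_dist syz]]]]] :=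
  fp_down ax ay.
by apply: metric_triangle (de _ _ _ exz) _ le; rewrite metric_sym; apply: ds.
Qed.

(** * The uniform structure on formal points *)

Lemma tildeP d alpha beta q : tilde d alpha beta q <->
  exists x eps y delta u, [/\ alpha (Ball d eps x), beta (Ball d delta y),
    d x y u & u%:num + eps%:num + delta%:num < q%:num].
Proof.
split=> [[x [eps [y [delta [ax b_y /ur_lt_posE/ur_add_posE]]]]]
        |[x [eps [y [delta [u [ax b_y dxy lt]]]]]]].
  move=> [v [/ur_add_posE[u [dxy lt]] lt']].
  by exists x, eps, y, delta, u; split=> //; lra.
exists x, eps, y, delta; split=> //; apply/ur_lt_posE/ur_add_posE.
(* The midpoint of [u + eps] and [q - delta] witnesses the inner sum. *)
have gt0 : 0 < (u%:num + eps%:num + q%:num - delta%:num) / 2.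
  by have := Qpos_gt0 u; have := Qpos_gt0 eps; lra.
exists (PosNum gt0); split; last by move=> /=; lra.
by apply/ur_add_posE; exists u; split=> //=; lra.
Qed.

Lemma tilde_common_center d x alpha eps beta delta q :
  alpha (Ball d eps x) -> beta (Ball d delta x) ->
  eps%:num + delta%:num < q%:num -> tilde d alpha beta q.
Proof.
move=> ax bx lt; apply/tildeP.
have gt0 : 0 < (q%:num - eps%:num - delta%:num) / 2 by lra.
exists x, eps, x, delta, (PosNum gt0); split=> //=; last by lra.
exact: metric_refl.
Qed.

(** Going from [x] to [x'] inside [alpha] and then to [y] requires radius [eps + eps' + u + delta],
    which is below [eps + q]. *)
Lemma tilde_expand d x alpha eps beta q r :
  alpha (Ball d eps x) -> tilde d alpha beta q ->
  eps%:num + q%:num <= r%:num -> beta (Ball d r x).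
Proof.
move=> ax /tildeP[x' [eps' [y [delta [u [ax' b_y dxy lt]]]]]] le.
have dxx' : d x x' (eps%:num + eps'%:num)%:pos.
  by apply: fp_dist ax ax' _ _ _.
have dxy' : d x y (eps%:num + eps'%:num + u%:num)%:pos.
  exact: metric_triangle dxx' dxy _.
by apply: fp_up b_y _; apply: ball_le_num dxy' _ => //=; lra.
Qed.

(** Expansion puts a ball around [x] into [beta], where it meets the ball around [y]. Taking the
    balls in a metric [s] above [d] lets the same centres serve two metrics when suprema are
    treated. *)
Lemma tilde_near s d x alpha eps y beta delta q r :
  alpha (Ball s eps x) -> beta (Ball s delta y) -> dist_le d s ->
  tilde d alpha beta q -> q%:num + eps%:num + delta%:num <= r%:num -> d x y r.
Proof.
move=> ax b_y ds dq le.
have ax' : alpha (Ball d eps x) by apply: fp_up ax _; apply: ball_le_center.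
have bx : beta (Ball d (eps%:num + q%:num)%:pos x) by apply: tilde_expand ax' dq _.
by apply: fp_dist bx b_y _ _ _ => //=; lra.
Qed.

Lemma tilde_refl d alpha q : tilde d alpha alpha q.
Proof.
have gt0 : 0 < q%:num / 3 by [].
have [x ax] := fp_small alpha d (PosNum gt0).
by apply: (tilde_common_center ax ax) => /=; have := Qpos_gt0 q; lra.
Qed.

Lemma tilde_sym d alpha beta : tilde d alpha beta = tilde d beta alpha.
Proof.
by apply: upper_real_ext => q;
  split=> /tildeP[x [eps [y [delta [u [ax b_y dxy lt]]]]]];
  apply/tildeP; exists y, delta, x, eps, u; split=> //; rewrite 1?metric_sym //; lra.
Qed.

Lemma tilde_gmetric d : gmetric (tilde d).
Proof.
split=> [alpha|alpha beta gamma q]; first exact/ur_eq_zero/tilde_refl.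
move=> [u [v [/ur_rounded[u' [ltu du]] dv qE]]].
(* The ball around [x] is carried from [alpha] to [beta] to [gamma]; the two copies of [eta] in the
   final sum fit into the room [u - u'] left by roundedness. *)
have gt0 : 0 < (u%:num - u'%:num) / 3 by lra.
set eta := PosNum gt0; have [x ax] := fp_small alpha d eta.
have bx : beta (Ball d (eta%:num + u'%:num)%:pos x).
  exact: tilde_expand ax du _.
have cx : gamma (Ball d (eta%:num + u'%:num + v%:num)%:pos x).
  exact: tilde_expand bx dv _.
by apply: tilde_common_center ax cx _ => /=; lra.
Qed.

Lemma tilde_mono d e : dist_le d e -> dist_le (tilde d) (tilde e).
Proof.
move=> de alpha beta q /tildeP[x [eps [y [delta [u [ax b_y exy lt]]]]]].
apply/tildeP; exists x, eps, y, delta, u; split=> //; last exact: de.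
- by apply: fp_up ax _; apply: ball_le_center.
- by apply: fp_up b_y _; apply: ball_le_center.
Qed.

Lemma tilde_sup d e s : is_sup d e s -> is_sup (tilde d) (tilde e) (tilde s).
Proof.
move=> sup; have [_ ds es _] := sup.
split; [exact: tilde_gmetric | exact: tilde_mono | exact: tilde_mono |].
move=> t _ dt et alpha beta q /ur_rounded[p [pq tp]].
have [dp ep] := (dt _ _ _ tp, et _ _ _ tp).
(* The centres are within [p + 2 * eta] for both metrics, and the radii add [2 * eta]; so [4 * eta]
   must be less than [q - p]. *)
have gt0 : 0 < (q%:num - p%:num) / 5 by lra.
set eta := PosNum gt0.
have [[x ax] [y b_y]] := (fp_small alpha s eta, fp_small beta s eta).
apply/tildeP; exists x, eta, y, eta, (p%:num + eta%:num + eta%:num)%:pos.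
split=> //; last by move=> /=; lra.
apply: is_sup_ptwise (metric_gmetric d) (metric_gmetric e) sup _ _.
  exact: tilde_near ax b_y ds dp _.
exact: tilde_near ax b_y es ep _.
Qed.

Lemma tilde_gus : is_gus (image_family (@tilde X)).
Proof.
split=> [_ [d ->]||_ _ [d ->] [e ->]]; first exact: tilde_gmetric.
  have [d Md] := gus_inhabited (gus_axioms X).
  by exists (tilde (exist _ d Md)), (exist _ d Md).
have [s sup] := metric_sup d e.
by exists (tilde s); split; [exists s | apply: tilde_sup].
Qed.

Lemma tilde_eq0_sub alpha beta :
  (forall d, tilde d alpha beta = ur_zero) -> forall a, alpha a -> beta a.
Proof.
move=> ab0 [d eps x] /fp_lt[[e delta y] [ay /ball_ltP[de [u [dxy lt]]]]].
(* By the slack from (U1), the inner ball enlarged by [eta] still lies below the given one. *)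
have gt0 : 0 < eps%:num - u%:num - delta%:num by lra.
set eta := PosNum gt0; have abq : tilde e alpha beta eta by rewrite ab0 /=.
have b_y : beta (Ball e (delta%:num + eta%:num)%:pos y).
  exact: tilde_expand ay abq _.
by apply: fp_up b_y _; apply: ball_le_num de dxy _ => /=; lra.
Qed.

Lemma tilde_separated : separated_gus (image_family (@tilde X)).
Proof.
move=> alpha beta; split=> [ab0 | -> _ [d ->]]; last exact/ur_eq_zero/tilde_refl.
have ab0' d : tilde d alpha beta = ur_zero by apply: ab0; exists d.
apply: formal_point_ext => a; split; apply: tilde_eq0_sub => // d.
by rewrite tilde_sym.
Qed.

(** * The embedding of the space into its formal points *)

Lemma diamond_center d x eps : diamond x (Ball d eps x).
Proof. by apply/ur_lt_posE; apply: metric_refl. Qed.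

Lemma diamond_isometry d x y : d x y = tilde d (diamond x) (diamond y).
Proof.
apply: upper_real_ext => q; split=> /ur_rounded[p [pq dp]].
  have gt0 : 0 < (q%:num - p%:num) / 3 by lra.
  apply/tildeP; exists x, (PosNum gt0), y, (PosNum gt0), p.
  by split=> //=; [exact: diamond_center | exact: diamond_center | lra].
(* The two radii may fill the gap exactly, as the bound in [tilde_near] is not strict. *)
have gt0 : 0 < (q%:num - p%:num) / 2 by lra.
apply: tilde_near (diamond_center d x (PosNum gt0))
  (diamond_center d y (PosNum gt0)) _ dp _ => //=; lra.
Qed.

Lemma diamond_dense alpha d eps :
  exists x, (tilde d alpha (diamond x) < eps%:ur)%ur.
Proof.
have gt0 : 0 < eps%:num / 3 by [].
have [x ax] := fp_small alpha d (PosNum gt0).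
exists x; apply/ur_lt_posE.
apply: tilde_common_center ax (diamond_center d x (PosNum gt0)) _ => /=.
by have := Qpos_gt0 eps; lra.
Qed.

(** * Limits of Cauchy filters *)

Section CauchyLimit.
Variable F : (Pt X -> Prop) -> Prop.
Hypothesis cauchyF : cauchy_filter (image_family (@tilde X)) F.

(* The strict inequality makes the limit satisfy axiom (U1). *)
Definition limit_set (a : ball X) : Prop :=
  exists b, ball_lt b a /\ F (fun gamma => gamma b).

(** The Cauchy condition supplies a formal point as centre; a small ball of that point supplies a
    centre in [X], and expansion carries the enlarged ball to all nearby points. *)
Lemma cauchy_small d eps : exists x, F (fun gamma => gamma (Ball d eps x)).
Proof.
have gt0 : 0 < eps%:num / 2 by [].
have [|beta Fb] := cf_cauchy cauchyF (d := tilde d) _ (PosNum gt0).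
  by exists d.
have [x bx] := fp_small beta d (PosNum gt0).
exists x; apply: cf_superset cauchyF _ _ _ Fb => gamma /ur_lt_posE bc.
by apply: tilde_expand bx bc _ => /=; lra.
Qed.

Lemma limit_small d eps : exists x, limit_set (Ball d eps x).
Proof.
have gt0 : 0 < eps%:num / 2 by [].
have [x Fx] := cauchy_small d (PosNum gt0).
exists x, (Ball d (PosNum gt0) x); split=> //; apply: ball_lt_center => /=.
by have := Qpos_gt0 eps; lra.
Qed.

Lemma limit_inhabited : exists a, limit_set a.
Proof.
have [d Md] := gus_inhabited (gus_axioms X).
have [x ax] := limit_small (exist _ d Md) 1%:pos.
by exists (Ball (exist _ d Md) 1%:pos x).
Qed.

Lemma limit_up a b : ball_le a b -> limit_set a -> limit_set b.
Proof.
by move=> ab [c [ca Fc]]; exists c; split=> //; apply: ball_lt_le_trans ab.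
Qed.

Lemma limit_down a b : limit_set a -> limit_set b ->
  exists c, limit_set c /\ down (@ball_le X) (eq a) (eq b) c.
Proof.
case: a b => [d eps x] [e delta y].
move=> [[d1 eps1 x1] [/ball_ltP[dd1 [u [dx lt1]]] F1]].
move=> [[d2 eps2 x2] [/ball_ltP[ed2 [v [ey lt2]]] F2]].
have [s [_ d1s d2s _]] := metric_sup d1 d2.
(* One [eta] pays for the distance from [x1] or [x2] to the new centre, two for the radius of the
   refinement. *)
have [eta [le1 le2]] : exists eta : Qpos,
    u%:num + eps1%:num + 3 * eta%:num <= eps%:num /\
    v%:num + eps2%:num + 3 * eta%:num <= delta%:num.
  set m := Num.min (eps%:num - u%:num - eps1%:num)
                   (delta%:num - v%:num - eps2%:num).
  have m_gt0 : 0 < m / 3 by rewrite divr_gt0 // lt_min; apply/andP; split; lra.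
  have [m1 m2] : m <= eps%:num - u%:num - eps1%:num /\
      m <= delta%:num - v%:num - eps2%:num by rewrite !ge_min !lexx orbT.
  by exists (PosNum m_gt0) => /=; split; lra.
have [z Fz] := cauchy_small s eta.
(* Members of [F] are inhabited, and one formal point containing all three balls bounds the
   distances between their centres. *)
have [gamma [g1 [g2 gz]]] :=
  cf_inhabited cauchyF (cf_inter cauchyF F1 (cf_inter cauchyF F2 Fz)).
have d1z : d1 x1 z (eps1%:num + eta%:num)%:pos by apply: fp_dist g1 gz _ _ _.
have d2z : d2 x2 z (eps2%:num + eta%:num)%:pos by apply: fp_dist g2 gz _ _ _.
(* The radius is doubled to leave the ball of radius [eta], known to [F], strictly inside. *)
exists (Ball s (eta%:num + eta%:num)%:pos z); split.
  by exists (Ball s eta z); split=> //; apply: ball_lt_center; rewrite /= ltrDl.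
exists (Ball d eps x), (Ball e delta y); split=> //.
  have dz : d x z (u%:num + (eps1%:num + eta%:num))%:pos.
    by apply: metric_triangle dx (dd1 _ _ _ d1z) _.
  by apply: ball_le_num dz _ => [? ? ? /d1s/dd1 //|/=]; lra.
have ez : e y z (v%:num + (eps2%:num + eta%:num))%:pos.
  by apply: metric_triangle ey (ed2 _ _ _ d2z) _.
by apply: ball_le_num ez _ => [? ? ? /d2s/ed2 //|/=]; lra.
Qed.

(** Induction on the generated cover: (U1) holds by interpolating in the strict order, (U2) by the
    small balls that the Cauchy condition gives. *)
Lemma limit_cov a (U : ball X -> Prop) : limit_set a -> ball_cov a U ->
  exists b, limit_set b /\ U b.
Proof.
move=> la aU; elim: aU la => {a U}.
- by move=> U a Ua la; exists a.
- by move=> a U V _ IHU _ IHV /IHU[b [lb Ub]]; apply: (IHV b).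
- move=> a U V _ IHU _ IHV la.
  have [[b [lb Ub]] [c [lc Vc]]] := (IHU la, IHV la).
  have [e [le [_ [_ [<- <- eb ec]]]]] := limit_down lb lc.
  by exists e; split=> //; exists b, c.
- by move=> a b ab la; exists b; split=> //; apply: limit_up la.
move=> a _ [{}a|{}a d eps] la.
  have [b [/ball_lt_interpolate[c [bc ca]] Fb]] := la.
  by exists c; split=> //; exists b.
by have [x lx] := limit_small d eps; exists (Ball d eps x); split=> //; exists x.
Qed.

Definition limit : Pt X :=
  @FormalPoint (localic_completion X) limit_set
    limit_inhabited limit_down limit_cov.

Lemma limit_converges : converges (image_family (@tilde X)) F limit.
Proof.
move=> _ [d ->] eps.
(* Points of the filter set contain the ball of radius [eps / 4], and the limit a strictly larger
   one, of radius [eps / 2]; the sum stays below [eps]. *)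
have gt0 : 0 < eps%:num / 4 by [].
have gt0' : 0 < eps%:num / 2 by [].
have [x Fx] := cauchy_small d (PosNum gt0).
have lx : limit (Ball d (PosNum gt0') x).
  exists (Ball d (PosNum gt0) x); split=> //; apply: ball_lt_center => /=.
  by have := Qpos_gt0 eps; lra.
apply: cf_superset cauchyF _ _ _ Fx => gamma cx; apply/ur_lt_posE.
by apply: tilde_common_center lx cx _ => /=; have := Qpos_gt0 eps; lra.
Qed.

End CauchyLimit.

End Completion.

Theorem theorem3p30 (X : gus) (symX : symmetric_gus (@gus_dist X)) :
  is_completion (@tilde X) (@diamond X).
Proof.
split.
- exact: tilde_gus.
- by move=> _ [d ->]; apply: tilde_sym.
- by move=> F cauchyF; exists (limit symX cauchyF); apply: limit_converges.
- exact: tilde_separated.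
- exact: diamond_isometry.
- by move=> alpha d eps; apply: diamond_dense.
Qed.
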